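(* Let $D\subseteq\mathbb{C}$ be a domain in the upper half-plane, let $\Omega_D$ be the axially symmetric open set in $\mathbb{R}^6$ induced by $D$, and let $\tilde f_1(x)=A(x_0,r)+\underline{\omega}B(x_0,r)$ be an axially bi-harmonic function on $\Omega_D$. Then $A=A(x_0,r)$ and $B=B(x_0,r)$ satisfy the system $$\begin{cases} \partial_{x_0}^4A+2\partial_{x_0}^2\partial_r^2A+\partial_r^4A-\dfrac8{r^3}\partial_rA+\dfrac8{r^2}\partial_r^2A+\dfrac8r\partial_r^3A+\dfrac4r\partial_r\partial_{x_0}^2A=0,\\[2mm] \partial_r^4B+\dfrac8r\partial_r^3B-\dfrac{24}{r^3}\partial_rB+\dfrac{24}{r^4}B+2\partial_r^2\partial_{x_0}^2B-\dfrac8{r^2}\partial_{x_0}^2B+\dfrac8r\partial_{x_0}^2\partial_rB+\partial_{x_0}^4B=0. \end{cases}$$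
   Context: $\mathbb{R}_5$ is the real Clifford algebra generated by $e_1,\dots,e_5$ with $e_i^2=-1$, $e_ie_j=-e_je_i$ for $i\ne j$. $\mathbb{R}^6$ is identified with the paravectors $x=x_0+\underline{x}$, $\underline{x}=\sum_{i=1}^5x_ie_i=r\underline{\omega}$, with $r=|\underline{x}|>0$ and $\underline{\omega}\in\mathbb{S}=\{\underline{x}:|\underline{x}|=1\}$. The set induced by $D$ is $\Omega_D=\{x=x_0+\underline{x}\in\mathbb{R}^6:(x_0,|\underline{x}|)\in D\}$. A function $f:\Omega_D\to\mathbb{R}_5$ is of axial type (a slice function) if $f(x)=A(x_0,r)+\underline{\omega}B(x_0,r)$ with $A,B$ $\mathbb{R}_5$-valued and independent of $\underline{\omega}\in\mathbb{S}$. $\mathcal{D}=\partial_{x_0}+\sum_{i=1}^5e_i\partial_{x_i}$ is the Dirac operator and $\Delta=\sum_{i=0}^5\partial_{x_i}^2$ is the Laplace operator in $\mathbb{R}^6$. An axially bi-harmonic function on $\Omega_D$ is a function of the form $\tilde f_1=\mathcal{D}f$, where $f:\Omega_D\to\mathbb{R}_5$ is of axial type and of class $\mathcal{C}^5(\Omega_D)$, and which satisfies $\Delta^2\tilde f_1=0$ on $\Omega_D$.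
   Formalization: The last term of the first equation, printed as (4/r) ∂_r∂_{x_0}^2 A, is corrected to (8/r) ∂_r∂_{x_0}^2 A; the printed equation fails for the bi-harmonic A = 3x_0^2 r^2 − 5x_0^4, B = 0. *)

(* Defs.v *)
From HB Require Import structures.
From mathcomp Require Import all_boot all_order all_algebra.
From mathcomp Require Import all_classical all_reals all_analysis.
Set Implicit Arguments.
Unset Strict Implicit.
Unset Printing Implicit Defensive.
Import Order.TTheory GRing.Theory Num.Theory.
Import numFieldNormedType.Exports.
Local Open Scope classical_set_scope.
Local Open Scope ring_scope.

(* The real Clifford algebra R_n with e_i ^ 2 = -1 and e_i e_j = - e_j e_i.
   An element is the row of its 2 ^ n coordinates on the blades
   e_A = e_(i1) ... e_(ik), A = {i1 < ... < ik}; as a normed module it is the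
   underlying space of row vectors. *)
Definition clifford (R : realType) (n : nat) : Type := 'rV[R]_#|{set 'I_n}|.

HB.instance Definition _ (R : realType) (n : nat) :=
  NormedModule.on (clifford R n).

Section CliffordAlgebra.
Variables (R : realType) (n : nat).
Implicit Types (A B C : {set 'I_n}) (x y z : clifford R n).

Definition blade A : clifford R n := delta_mx 0 (enum_rank A).

Definition coef x A : R := (x : 'rV[R]_#|{set 'I_n}|) 0 (enum_rank A).

Definition symdiff A B : {set 'I_n} := (A :\: B) :|: (B :\: A).

(* e_A e_B = blade_sign A B e_(symdiff A B): one factor -1 for each pair
   j < i to be swapped, and one for each square e_i e_i. *)
Definition blade_sign A B : R :=
  \prod_(i in A) \prod_(j in B | (j <= i)%N) (-1).

Definition clifford_one : clifford R n := blade finset.set0.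

Definition clifford_mul x y : clifford R n :=
  \sum_A \sum_B (coef x A * coef y B * blade_sign A B) *: blade (symdiff A B).

Lemma coefD x y A : coef (x + y) A = coef x A + coef y A.
Proof. by rewrite /coef mxE. Qed.

Lemma coefZ a x A : coef (a *: x) A = a * coef x A.
Proof. by rewrite /coef mxE. Qed.

Lemma coef_blade A B : coef (blade A) B = (A == B)%:R.
Proof. by rewrite /coef /blade mxE eqxx /= (inj_eq enum_rank_inj) eq_sym. Qed.

Lemma clifford_basis x : x = \sum_A coef x A *: blade A.
Proof.
rewrite [LHS](row_sum_delta (x : 'rV[R]_#|{set 'I_n}|)).
rewrite (reindex enum_rank) //=.
by exists enum_val => A _; rewrite ?enum_rankK ?enum_valK.
Qed.

Lemma clifford_mulDl : left_distributive clifford_mul +%R.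
Proof.
move=> x y z; rewrite /clifford_mul -big_split; apply: eq_bigr => A _ /=.
rewrite -big_split; apply: eq_bigr => B _ /=.
by rewrite coefD -scalerDl !mulrDl.
Qed.

Lemma clifford_mulDr : right_distributive clifford_mul +%R.
Proof.
move=> x y z; rewrite /clifford_mul -big_split; apply: eq_bigr => A _ /=.
rewrite -big_split; apply: eq_bigr => B _ /=.
by rewrite coefD -scalerDl mulrDr !mulrDl.
Qed.

Lemma clifford_scalerAl a x y :
  a *: clifford_mul x y = clifford_mul (a *: x) y.
Proof.
rewrite /clifford_mul scaler_sumr; apply: eq_bigr => A _.
rewrite scaler_sumr; apply: eq_bigr => B _.
by rewrite coefZ scalerA !mulrA.
Qed.

Lemma clifford_scalerAr a x y :
  a *: clifford_mul x y = clifford_mul x (a *: y).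
Proof.
rewrite /clifford_mul scaler_sumr; apply: eq_bigr => A _.
rewrite scaler_sumr; apply: eq_bigr => B _.
by rewrite coefZ scalerA (mulrCA (coef x A)) !mulrA.
Qed.

Lemma blade_mul A B :
  clifford_mul (blade A) (blade B) = blade_sign A B *: blade (symdiff A B).
Proof.
rewrite /clifford_mul (bigD1 A) //= (bigD1 B) //= !coef_blade !eqxx !mul1r.
rewrite !big1 ?addr0 // => [C neC|C neC].
- rewrite big1 // => D _.
  by rewrite coef_blade eq_sym (negbTE neC) !mul0r scale0r.
- by rewrite !coef_blade (eq_sym B) (negbTE neC) mulr0 mul0r scale0r.
Qed.

Lemma clifford_mul_suml (I : finType) (F : I -> clifford R n) y :
  clifford_mul (\sum_i F i) y = \sum_i clifford_mul (F i) y.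
Proof.
apply: (big_morph (clifford_mul^~ y)) => [u v|]; first exact: clifford_mulDl.
by have := clifford_scalerAl 0 0 y; rewrite !scale0r => <-.
Qed.

Lemma clifford_mul_sumr (I : finType) (F : I -> clifford R n) x :
  clifford_mul x (\sum_i F i) = \sum_i clifford_mul x (F i).
Proof.
apply: (big_morph (clifford_mul x)) => [u v|]; first exact: clifford_mulDr.
by have := clifford_scalerAr 0 x 0; rewrite !scale0r => <-.
Qed.

Lemma in_symdiff A B i : (i \in symdiff A B) = (i \in A) (+) (i \in B).
Proof. by rewrite !inE; case: (i \in A); case: (i \in B). Qed.

Lemma symdiffA : associative symdiff.
Proof. by move=> A B C; apply/setP => i; rewrite !in_symdiff addbA. Qed.

Lemma prod_symdiff (g : 'I_n -> R) A B : (forall i, g i * g i = 1) ->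
  \prod_(i in symdiff A B) g i = (\prod_(i in A) g i) * \prod_(i in B) g i.
Proof.
move=> gg; rewrite ![\prod_(i in _) _]big_mkcond -big_split /=.
apply: eq_bigr => i _; rewrite in_symdiff.
by case: (i \in A); case: (i \in B); rewrite /= ?mulr1 ?mul1r.
Qed.

Lemma prodN1_sq (I : finType) (P : pred I) :
  (\prod_(i | P i) (-1 : R)) * \prod_(i | P i) -1 = 1.
Proof. by rewrite -big_split big1 //= => i _; rewrite mulrNN mulr1. Qed.

Lemma blade_signDl A B C :
  blade_sign (symdiff A B) C = blade_sign A C * blade_sign B C.
Proof. by apply: prod_symdiff => i; apply: prodN1_sq. Qed.

Lemma blade_signDr A B C :
  blade_sign A (symdiff B C) = blade_sign A B * blade_sign A C.
Proof.
rewrite /blade_sign -big_split; apply: eq_bigr => i _ /=.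
rewrite !big_mkcondr; apply: prod_symdiff => j.
by case: ifP; rewrite ?mulrNN mulr1.
Qed.

Lemma blade_mulA A B C :
  clifford_mul (blade A) (clifford_mul (blade B) (blade C)) =
  clifford_mul (clifford_mul (blade A) (blade B)) (blade C).
Proof.
rewrite !blade_mul -clifford_scalerAr -clifford_scalerAl !blade_mul !scalerA.
rewrite blade_signDl blade_signDr symdiffA; congr (_ *: _).
by rewrite mulrC -mulrA; congr (_ * _); rewrite mulrC.
Qed.

Lemma clifford_mulA : associative clifford_mul.
Proof.
have basis u : exists c : {set 'I_n} -> R, u = \sum_A c A *: blade A.
  by exists (coef u); exact: clifford_basis.
move=> x y z; have [c ->] := basis x.
rewrite (clifford_mul_suml _ y) (clifford_mul_suml _ (clifford_mul y z)).
rewrite (clifford_mul_suml _ z); apply: eq_bigr => A _.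
rewrite -(clifford_scalerAl _ _ (clifford_mul y z)).
rewrite -(clifford_scalerAl _ _ y) -(clifford_scalerAl _ _ z); congr (_ *: _); have [d ->] := basis y.
rewrite (clifford_mul_suml _ z) !(clifford_mul_sumr _ (blade A)).
rewrite (clifford_mul_suml _ z); apply: eq_bigr => B _.
rewrite -(clifford_scalerAl _ _ z) -!(clifford_scalerAr _ (blade A)).
rewrite -(clifford_scalerAl _ _ z); congr (_ *: _); have [e ->] := basis z.
rewrite (clifford_mul_sumr _ (blade B)) (clifford_mul_sumr _ (blade A)).
rewrite (clifford_mul_sumr _ (clifford_mul _ _)); apply: eq_bigr => C _.
rewrite -(clifford_scalerAr _ (blade B)) -(clifford_scalerAr _ (blade A)).
by rewrite -(clifford_scalerAr _ (clifford_mul _ _)) blade_mulA.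
Qed.

Lemma clifford_mul1x : left_id clifford_one clifford_mul.
Proof.
move=> x; rewrite {1}(clifford_basis x) clifford_mul_sumr.
rewrite [RHS]clifford_basis; apply: eq_bigr => A _.
rewrite -clifford_scalerAr blade_mul /blade_sign big_set0 scale1r.
by congr (_ *: blade _); apply/setP => i; rewrite in_symdiff inE.
Qed.

Lemma clifford_mulx1 : right_id clifford_one clifford_mul.
Proof.
move=> x; rewrite {1}(clifford_basis x) clifford_mul_suml.
rewrite [RHS]clifford_basis; apply: eq_bigr => A _.
rewrite -clifford_scalerAl blade_mul /blade_sign big1 ?scale1r => [|i _].
  by congr (_ *: blade _); apply/setP => i; rewrite in_symdiff inE addbF.
by rewrite big1 // => j; rewrite inE.
Qed.

Lemma clifford_one_neq0 : clifford_one != 0.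
Proof.
apply/eqP => /(congr1 (fun x => coef x finset.set0)); rewrite coef_blade eqxx.
by rewrite /coef mxE => /eqP; rewrite oner_eq0.
Qed.

HB.instance Definition _ := GRing.Zmodule_isNzRing.Build (clifford R n)
  clifford_mulA clifford_mul1x clifford_mulx1 clifford_mulDl clifford_mulDr
  clifford_one_neq0.

HB.instance Definition _ :=
  GRing.Lmodule_isLalgebra.Build R (clifford R n) clifford_scalerAl.

HB.instance Definition _ :=
  GRing.Lalgebra_isAlgebra.Build R (clifford R n) clifford_scalerAr.

Definition gen (i : 'I_n) : clifford R n := blade [set i]%SET.

Lemma gen_sqr i : gen i * gen i = -1.
Proof.
rewrite -[LHS]/(clifford_mul _ _) blade_mul /blade_sign big_set1.
rewrite (big_pred1 i) => [|j]; last first.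
  by rewrite /= inE; case: eqP => // ->; rewrite leqnn.
rewrite scaleN1r; congr (- _); rewrite -[RHS]/(blade finset.set0).
congr blade; apply/setP => j.
by rewrite in_symdiff addbb inE.
Qed.

Lemma gen_anticomm i j : i != j -> gen i * gen j = - (gen j * gen i).
Proof.
suff H (k l : 'I_n) : (k < l)%N -> gen k * gen l = - (gen l * gen k).
  move=> neij; have [lt_ij|lt_ji|/val_inj eqij] := ltngtP i j.
  - exact: H.
  - by rewrite (H j i) // opprK.
  - by rewrite eqij eqxx in neij.
move=> ltkl; rewrite -[gen k * _]/(clifford_mul _ _).
rewrite -[gen l * _]/(clifford_mul _ _) !blade_mul /blade_sign !big_set1.
rewrite big1 => [|h]; last by rewrite inE => /andP[/eqP-> ]; rewrite leqNgt ltkl.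
rewrite (big_pred1 k) => [|h]; last first.
  by rewrite /= inE; case: eqP => // ->; rewrite ltnW.
rewrite scaleN1r scale1r opprK; congr blade; apply/setP => h.
by rewrite !in_symdiff addbC.
Qed.

End CliffordAlgebra.

(* [C_k E U k f]: f is of class C^k on the open set U, where E is the set of
   coordinate directions: all the iterated partial derivatives of f of order at
   most k exist and are continuous on U. *)
Fixpoint C_k (R : realType) (V W : normedModType R) (E U : set V) (k : nat)
    (f : V -> W) : Prop :=
  {in U, continuous f} /\
  match k with
  | 0 => True
  | k'.+1 => forall v, E v ->
      (forall x, U x -> derivable f x v) /\ C_k E U k' ('D_v f)
  end.

Section Paravectors.
Variables (R : realType) (n : nat).
(* The paravector x_0 + \sum_(1 <= i <= n) x_i e_i is the row (x_0, ..., x_n);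
   the norm that 'rV[R]_n.+1 carries in the library is the sup norm, hence the
   explicit Euclidean norm below. *)
Implicit Types (x : 'rV[R]_n.+1) (f : 'rV[R]_n.+1 -> clifford R n).

Definition coord x (i : 'I_n.+1) : R := x 0 i.

Definition repart x : R := coord x ord0.

Definition vnorm x : R := Num.sqrt (\sum_(i < n) coord x (lift ord0 i) ^+ 2).

Definition vdir x : clifford R n :=
  (vnorm x)^-1 *: \sum_(i < n) coord x (lift ord0 i) *: gen R i.

Definition coord_dirs : set 'rV[R]_n.+1 := [set delta_mx 0 i | i in setT].

Definition pderiv (i : 'I_n.+1) f : 'rV[R]_n.+1 -> clifford R n :=
  'D_(delta_mx 0 i) f.

Definition dirac f : 'rV[R]_n.+1 -> clifford R n :=
  fun x => pderiv ord0 f x + \sum_(i < n) gen R i * pderiv (lift ord0 i) f x.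

Definition laplacian f : 'rV[R]_n.+1 -> clifford R n :=
  fun x => \sum_(i < n.+1) pderiv i (pderiv i f) x.

Definition induced_set (D : set (R * R)) : set 'rV[R]_n.+1 :=
  [set x | D (repart x, vnorm x)].

Definition axial_repr (D : set (R * R)) f (A B : R * R -> clifford R n) :=
  forall x, induced_set D x ->
    f x = A (repart x, vnorm x) + vdir x * B (repart x, vnorm x).

Definition axial_type (D : set (R * R)) f := exists A B, axial_repr D f A B.

End Paravectors.

Arguments induced_set {R} n D.
Arguments coord_dirs {R} n.

Definition axially_biharmonic (R : realType) (D : set (R * R))
    (g : 'rV[R]_6 -> clifford R 5) : Prop :=
  (exists f : 'rV[R]_6 -> clifford R 5,
    [/\ axial_type D f,
        C_k (coord_dirs 5) (induced_set 5 D) 5 f &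
        forall x, induced_set 5 D x -> g x = dirac f x]) /\
  (forall x, induced_set 5 D x -> laplacian (laplacian g) x = 0).

(* C is identified with R * R through u + i v |-> (u, v). *)
Definition upper_half_plane_domain (R : realType) (D : set (R * R)) : Prop :=
  [/\ open D, connected D, D !=set0 & forall p, D p -> 0 < p.2].

(* On axial functions of R^6 the Laplacian acts as d_x0^2 + d_r^2 + (4 / r) d_r
   on A and as d_x0^2 + d_r^2 + (4 / r) d_r - 4 / r^2 on B; the equations for a
   bi-harmonic A + omega B are the squares of these two operators.  In
   particular the term d_r d_x0^2 carries the coefficient 8 / r in both of them.
   (A coefficient 4 / r in the equation for A would be wrong: A = 3 x_0^2 r^2 -
   5 x_0^4, B = 0 is bi-harmonic and is the image under the Dirac operator of the
   axial x_0^3 r^2 - (3 / 2) x_0^5 - omega (1 / 2) x_0^4 r.) *)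
Definition d_x0 (R : realType) (W : normedModType R) (F : R * R -> W) :
  R * R -> W := 'D_((1, 0) : R * R) F.

Definition d_r (R : realType) (W : normedModType R) (F : R * R -> W) :
  R * R -> W := 'D_((0, 1) : R * R) F.

Definition plane_dirs (R : realType) : set (R * R) :=
  [set v | v = (1, 0) \/ v = (0, 1)].

Arguments plane_dirs R : clear implicits.
Arguments d_x0 {R W} F.
Arguments d_r {R W} F.

(* Main.v *)
From HB Require Import structures.
Require Import Defs.
From mathcomp Require Import all_boot all_order all_algebra.
From mathcomp Require Import all_classical all_reals all_analysis.
From mathcomp Require Import ring.
Import Order.TTheory GRing.Theory Num.Theory.
Import numFieldNormedType.Exports.
Local Open Scope classical_set_scope.
Local Open Scope ring_scope.

(** In R^(n+1) the Laplacian maps an axial function A + omega B to another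
    axial function, with components L_0 A and L_(n-1) B, where
      L_c F = d_x0^2 F + d_r^2 F + ((n-1) / r) d_r F - (c / r^2) F
    (laplacian_axial).  Hence a bi-harmonic A + omega B satisfies
    L_0 (L_0 A) + omega L_(n-1) (L_(n-1) B) = 0 for every direction omega.
    Comparing two different directions separates the components
    (axial_components_eq0), so that both iterates vanish.  Expanding them
    (axial_bilaplacianE) and setting n = 5 gives the two equations.

    The Laplacian of an axial function is computed with the direction cosines
    c_i = x_i / r: along e_i the variable x_0 is fixed, so only r and omega
    vary, with d_i r = c_i, d_i c_j = (delta_ij - c_i c_j) / r and
    d_i omega = (e_i - c_i omega) / r.  Every step is a one-variable chain rule.
    The identities sum c_i^2 = 1 and sum c_i e_i = omega conclude.

    Smoothness of the components is obtained algebraically.  On the half-plane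
    of the points x_0 + r e_i the function is A + e_i B; from two of these
    half-planes A and B are recovered by linear operations, and so inherit the
    C^4 regularity of the Dirac image of a C^5 function
    (C_k_axial_components).

    The order in which the mixed derivatives appear is immaterial by Schwarz's
    theorem, which is proved here from the mean value theorem on the real
    coordinates (mixed_derivatives_commute). *)

(** * Directional derivatives *)

Section DirectionalDerivatives.
Set Implicit Arguments.
Unset Strict Implicit.
Variable R : realType.
Implicit Types V W : normedModType R.

(** A directional derivative is the derivative at 0 of the restriction to a
    line; this reduces every rule below to one real variable. *)
Lemma is_derive_lineP V W (f : V -> W) x v df :
  is_derive x v f df <-> is_derive (0 : R) 1 (fun h : R => f (h *: v + x)) df.
Proof.
have E : 'D_v f x = 'D_1 (fun h : R => f (h *: v + x)) 0.
  rewrite /derive; set g1 := fun h => h^-1 *: _.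
  set g2 := fun h => h^-1 *: (((fun _ => _) \o _) _ - _).
  suff -> : g1 = g2 by []; apply/funext => h; rewrite /g1 /g2 /=.
  by rewrite addr0 scale0r add0r [_%:A]mulr1.
split=> -[fx <-]; constructor => //.
  exact: (derivable1P _ _ _).1.
exact: (derivable1P _ _ _).2.
Qed.

Lemma is_derive_translate V W (f : V -> W) q v (t : R) df :
  is_derive (t *: v + q) v f df -> is_derive t 1 (fun s => f (s *: v + q)) df.
Proof.
move=> /is_derive_lineP H; apply/is_derive_lineP; move: H.
congr is_derive; apply/funext => h.
by rewrite [h%:A]mulr1 scalerDl addrA.
Qed.

Lemma derivable_continuous_line V W (f : V -> W) x v :
  derivable f x v -> f (h *: v + x) @[h --> (0 : R)] --> f x.
Proof.
move=> /derivable1P/derivable1_diffP/differentiable_continuous H.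
by have := H; rewrite /prop_for /continuous_at /= scale0r add0r.
Qed.

Lemma is_derive_comp_real V W (phi : V -> R) (G : R -> W) x v dphi dG :
  is_derive x v phi dphi -> is_derive (phi x) 1 G dG ->
  is_derive x v (fun y => G (phi y)) (dphi *: dG).
Proof.
move=> /is_derive_lineP[phix phiE] [Gx GE]; apply/is_derive_lineP.
set p := fun h : R => phi (h *: v + x).
have p0 : p 0 = phi x by rewrite /p scale0r add0r.
move/derivable1_diffP: phix => dp; move: Gx GE; rewrite -p0 => Gx GE.
move/derivable1_diffP: (Gx) => dG'.
have dGp : differentiable (G \o p) 0 by exact: differentiable_comp.
constructor; first exact/derivable1_diffP.
rewrite -[LHS]/('D_1 (G \o p) 0) deriveE // diff_comp //=.
rewrite -[X in 'd G _ X]deriveE // phiE -[X in 'd _ _ X]mulr1.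
by rewrite [LHS]linearZ /= -deriveE // GE.
Qed.

(** Leibniz rule.  One lemma serves both the action of the scalars and the
    product of the Clifford algebra, which is not commutative and hence not
    covered by the product rule for real functions.  The difference quotient
    splits as b (quotient of f) (g (x + h v)) + b (f x) (quotient of g); g need
    only be continuous along the line, which its derivability gives. *)
Lemma is_derive_bilinear V W1 W2 W3 (b : W1 -> W2 -> W3)
    (f : V -> W1) (g : V -> W2) x v df dg :
  (forall y, linear (b^~ y)) -> (forall y, linear (b y)) ->
  continuous (fun p => b p.1 p.2) ->
  is_derive x v f df -> is_derive x v g dg ->
  is_derive x v (fun y => b (f y) (g y)) (b df (g x) + b (f x) dg).
Proof.
move=> bl br bc [dfx <-] [dgx <-].
pose bl' y := GRing.isLinear.Build _ _ _ _ _ (bl y).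
pose br' y := GRing.isLinear.Build _ _ _ _ _ (br y).
pose Bl y : {linear W1 -> W3} := HB.pack (b^~ y) (bl' y).
pose Br y : {linear W2 -> W3} := HB.pack (b y) (br' y).
have bZBl y a u w : b (a *: (u - w)) y = a *: (b u y - b w y).
  by rewrite -![b _ y]/(Bl y _) linearZ linearB.
have bZBr y a u w : b y (a *: (u - w)) = a *: (b y u - b y w).
  by rewrite -![b y _]/(Br y _) linearZ linearB.
suff H : (fun h : R => h^-1 *: (((fun y => b (f y) (g y)) \o shift x) (h *: v)
    - b (f x) (g x))) @ 0^' --> b ('D_v f x) (g x) + b (f x) ('D_v g x).
  by split; [apply/cvg_ex; eexists; exact: H | exact: cvg_lim H].
rewrite (_ : (fun h : R => _) = fun h : R =>
   b (h^-1 *: ((f \o shift x) (h *: v) - f x)) (g (h *: v + x))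
   + b (f x) (h^-1 *: ((g \o shift x) (h *: v) - g x))); last first.
  apply/funext => h /=.
  by rewrite bZBl bZBr -scalerDr addrA subrK.
apply: cvgD.
  apply: (cvg_comp2 _ _ (bc (_, _))); first exact: dfx.
  by apply: cvg_within_filter; exact: derivable_continuous_line.
by apply: (cvg_comp2 (cvg_cst _) _ (bc (_, _))); exact: dgx.
Qed.

Lemma is_derive_scale V W (k : V -> R) (f : V -> W) x v dk df :
  is_derive x v k dk -> is_derive x v f df ->
  is_derive x v (fun y => k y *: f y) (dk *: f x + k x *: df).
Proof.
apply: is_derive_bilinear.
- by move=> y a k1 k2; rewrite scalerDl scalerA.
- by move=> y a k1 k2; rewrite scalerDr !scalerA mulrC.
- exact: scale_continuous.
Qed.

End DirectionalDerivatives.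

(** * Functions of class C^k *)

Section Smoothness.
Set Implicit Arguments.
Unset Strict Implicit.
Variable R : realType.
Implicit Types V W : normedModType R.

Lemma near_eq_open V W (U : set V) (f g : V -> W) x :
  open U -> {in U, f =1 g} -> U x -> \near x, f x = g x.
Proof.
move=> oU fg Ux; apply: filterS (open_nbhs_nbhs (conj oU Ux)) => y Uy.
by apply: fg; rewrite inE.
Qed.

Lemma C_k_continuous V W (E U : set V) k (f : V -> W) :
  C_k E U k f -> {in U, continuous f}.
Proof. by case: k => [|k] []. Qed.

Lemma C_kW V W (E U : set V) k (f : V -> W) : C_k E U k.+1 f -> C_k E U k f.
Proof.
elim: k f => [|k IHk] f /= [fc df]; split=> // v Ev.
by have [dfv Cf] := df v Ev; split=> //; exact: IHk.
Qed.

Lemma C_k_derive V W (E U : set V) k (f : V -> W) v :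
  E v -> C_k E U k.+1 f -> C_k E U k ('D_v f).
Proof. by move=> Ev /= [_ /(_ v Ev)[]]. Qed.

Lemma C_k_is_derive V W (E U : set V) k (f : V -> W) v x :
  E v -> U x -> C_k E U k.+1 f -> is_derive x v f ('D_v f x).
Proof. by move=> Ev Ux /= [_ /(_ v Ev)[df _]]; exact/derivableP/df. Qed.

Lemma eq_C_k V W (E U : set V) k (f g : V -> W) :
  open U -> {in U, f =1 g} -> C_k E U k f -> C_k E U k g.
Proof.
move=> oU; have nearfg f' g' x := @near_eq_open V W U f' g' x oU.
elim: k f g => [|k IHk] f g fg /= [fc df].
  split=> // x /[dup] xU /set_mem Ux; have fgx := nearfg _ _ _ fg Ux.
  rewrite /continuous_at -(fg x xU).
  by apply: cvg_trans (fc x xU); apply: near_eq_cvg.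
split.
  move=> x /[dup] xU /set_mem Ux; have fgx := nearfg _ _ _ fg Ux.
  rewrite /continuous_at -(fg x xU).
  by apply: cvg_trans (fc x xU); apply: near_eq_cvg.
move=> v Ev; have [dfv Cf] := df v Ev; split.
  move=> x Ux; apply: near_eq_derivable (dfv x Ux); exact: nearfg.
apply: IHk Cf => x /set_mem Ux; apply: near_eq_derive; exact: nearfg.
Qed.

(** Introduction rule: the derivatives may be given by any formula valid on
    the open set, since C^k regularity there only depends on the values
    there. *)
Lemma C_kS V W (E U : set V) k (f : V -> W) (df : V -> V -> W) :
  open U -> {in U, continuous f} ->
  (forall v x, E v -> U x -> is_derive x v f (df v x)) ->
  (forall v, E v -> C_k E U k (df v)) -> C_k E U k.+1 f.
Proof.
move=> oU fc fdf Cdf; split=> // v Ev; split=> [x Ux|].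
  by have [] := fdf v x Ev Ux.
apply: eq_C_k (Cdf v Ev) => // x /set_mem Ux.
by have [_ ->] := fdf v x Ev Ux.
Qed.

Lemma C_k_cst V W (E U : set V) k (w : W) : open U -> C_k E U k (fun=> w).
Proof.
move=> oU; elim: k w => [|k IHk] w; first by split=> // x _; exact: cvg_cst.
by apply: (@C_kS _ _ _ _ _ _ (fun _ _ => 0)) => // x _; exact: cvg_cst.
Qed.

Lemma C_kD V W (E U : set V) k (f g : V -> W) :
  open U -> C_k E U k f -> C_k E U k g -> C_k E U k (fun x => f x + g x).
Proof.
move=> oU; elim: k f g => [|k IHk] f g Cf Cg.
  split=> // x xU.
  by apply: cvgD; [exact: (C_k_continuous Cf)|exact: (C_k_continuous Cg)].
apply: (@C_kS _ _ _ _ _ _ (fun v x => 'D_v f x + 'D_v g x)) => //.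
- move=> x xU.
  by apply: cvgD; [exact: (C_k_continuous Cf)|exact: (C_k_continuous Cg)].
- move=> v x Ev Ux.
  exact: is_deriveD (C_k_is_derive Ev Ux Cf) (C_k_is_derive Ev Ux Cg).
- by move=> v Ev; apply: IHk; exact: C_k_derive.
Qed.

Lemma C_k_sum V W (E U : set V) k (I : finType) (f : I -> V -> W) :
  open U -> (forall i, C_k E U k (f i)) -> C_k E U k (fun x => \sum_i f i x).
Proof.
move=> oU Cf; elim: (index_enum I) => [|i s IHs].
  by apply: eq_C_k (C_k_cst _ _ 0 oU) => // x _; rewrite big_nil.
by apply: eq_C_k (C_kD oU (Cf i) IHs) => // x _; rewrite big_cons.
Qed.

Lemma C_k_bilinear V W1 W2 W3 (E U : set V) k (b : W1 -> W2 -> W3)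
    (f : V -> W1) (g : V -> W2) :
  open U -> (forall y, linear (b^~ y)) -> (forall y, linear (b y)) ->
  continuous (fun p => b p.1 p.2) ->
  C_k E U k f -> C_k E U k g -> C_k E U k (fun x => b (f x) (g x)).
Proof.
move=> oU bl br bc.
have cont f' g' : {in U, continuous f'} -> {in U, continuous g'} ->
    {in U, continuous (fun x => b (f' x) (g' x))}.
  move=> f'c g'c x xU; exact: (cvg_comp2 (f'c x xU) (g'c x xU) (bc (_, _))).
elim: k f g => [|k IHk] f g Cf Cg.
  split=> //.
  by apply: cont; [exact: (C_k_continuous Cf)|exact: (C_k_continuous Cg)].
apply: (@C_kS _ _ _ _ _ _
  (fun v x => b ('D_v f x) (g x) + b (f x) ('D_v g x))) => //.
- by apply: cont; [exact: (C_k_continuous Cf)|exact: (C_k_continuous Cg)].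
- move=> v x Ev Ux.
  exact: is_derive_bilinear (C_k_is_derive Ev Ux Cf) (C_k_is_derive Ev Ux Cg).
- move=> v Ev; apply: C_kD => //; apply: IHk; do ?exact: C_k_derive;
  exact: C_kW.
Qed.

Lemma C_k_scale V W (E U : set V) k (a : V -> R) (f : V -> W) :
  open U -> C_k E U k a -> C_k E U k f -> C_k E U k (fun x => a x *: f x).
Proof.
move=> oU; apply: C_k_bilinear => //.
- by move=> y c k1 k2; rewrite scalerDl scalerA.
- by move=> y c k1 k2; rewrite scalerDr !scalerA mulrC.
- exact: scale_continuous.
Qed.

Lemma C_kZ V W (E U : set V) k (a : R) (f : V -> W) :
  open U -> C_k E U k f -> C_k E U k (fun x => a *: f x).
Proof.
by move=> oU; apply: (C_k_scale (a := fun=> a)) => //; exact: C_k_cst.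
Qed.

(** The difference quotient of f \o L along v is that of f along L v, so that
    the iterated derivatives correspond as soon as L maps distinguished
    directions to distinguished directions. *)
Lemma C_k_comp_linear V1 V2 W (E1 U1 : set V1) (E2 U2 : set V2) k
    (L : {linear V1 -> V2}) (f : V2 -> W) :
  continuous L -> {homo L : v / E1 v >-> E2 v} -> {homo L : x / U1 x >-> U2 x} ->
  C_k E2 U2 k f -> C_k E1 U1 k (f \o L).
Proof.
move=> Lc LE LU.
have cont g : {in U2, continuous g} -> {in U1, continuous (g \o L)}.
  move=> gc x /set_mem /LU/mem_set Ux.
  exact: cvg_comp (Lc x) (gc _ Ux).
have quotient g x v :
   (fun h : R => h^-1 *: (((g \o L) \o shift x) (h *: v) - (g \o L) x)) = (fun h : R => h^-1 *: ((g \o shift (L x)) (h *: L v) - g (L x))).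
  by apply/funext => h /=; rewrite linearP.
elim: k f => [|k IHk] f /= [fc df]; split=> //; do ?exact: cont.
move=> v /LE LEv; have [dfv Cf] := df _ LEv; split.
  by move=> x /LU LUx; rewrite /derivable quotient; exact: dfv.
rewrite (_ : 'D_v (f \o L) = 'D_(L v) f \o L); first exact: IHk.
by apply/funext => x; rewrite /derive quotient.
Qed.

End Smoothness.

(** * Symmetry of second derivatives *)

Section MixedDerivatives.
Set Implicit Arguments.
Unset Strict Implicit.
Variable R : realType.
Implicit Types V W : normedModType R.

Lemma is_derive_linear V W1 W2 (L : {linear W1 -> W2}) (f : V -> W1) x v df :
  continuous L -> is_derive x v f df -> is_derive x v (L \o f) (L df).
Proof.
move=> Lc [dfx <-].
suff H : (fun h : R => h^-1 *: (((L \o f) \o shift x) (h *: v) - (L \o f) x))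
    @ 0^' --> L ('D_v f x).
  by split; [apply/cvg_ex; eexists; exact: H | exact: cvg_lim H].
rewrite (_ : (fun h : R => _) =
  L \o (fun h : R => h^-1 *: ((f \o shift x) (h *: v) - f x))).
  exact: cvg_comp dfx (Lc _).
by apply/funext => h /=; rewrite linearZ_LR (linearB L).
Qed.

Lemma C_k_linear V W1 W2 (E U : set V) k (L : {linear W1 -> W2}) (f : V -> W1) :
  open U -> continuous L -> C_k E U k f -> C_k E U k (L \o f).
Proof.
move=> oU Lc.
have cont g : {in U, continuous g} -> {in U, continuous (L \o g)}.
  by move=> gc x xU; exact: cvg_comp (gc x xU) (Lc _).
elim: k f => [|k IHk] f Cf.
  by split=> //; apply: cont; exact: (C_k_continuous Cf).
apply: (@C_kS _ _ _ _ _ _ _ (fun v => L \o 'D_v f)) => //.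
- by apply: cont; exact: (C_k_continuous Cf).
- by move=> v x Ev Ux; apply: is_derive_linear => //; exact: C_k_is_derive Cf.
- by move=> v Ev; apply: IHk; exact: C_k_derive Cf.
Qed.

(** The second difference over the parallelogram spanned by h v and h w is
    symmetric in v and w, whereas the mean value theorem, applied first along
    v and then along w, expresses it as h^2 d_w d_v f at some point of the
    parallelogram. *)
Lemma second_difference V (E U : set V) (f : V -> R) v w x (h : R) :
  E v -> E w -> C_k E U 2 f -> 0 < h ->
  (forall s t, 0 <= s <= h -> 0 <= t <= h -> U (t *: w + (s *: v + x))) ->
  exists s t c, [/\ 0 <= s <= h, 0 <= t <= h,
    'D_w ('D_v f) (t *: w + (s *: v + x)) = c &
    f (h *: v + (h *: w + x)) - f (h *: v + x) - (f (h *: w + x) - f x)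
    = c * h * h].
Proof.
move=> Ev Ew Cf h0 Usq.
have h00 : 0 <= h by exact: ltW.
have Uv s : 0 <= s <= h -> U (s *: v + x).
  by move=> sh; have := Usq s 0 sh; rewrite scale0r add0r lexx h00; exact.
have Uvw s : 0 <= s <= h -> U (s *: v + (h *: w + x)).
  by move=> sh; rewrite addrCA; apply: Usq => //; rewrite lexx h00.
have oo_cc s : s \in `]0, h[ -> 0 <= s <= h.
  by rewrite in_itv /= => /andP[/ltW -> /ltW ->].
have D1 s : 0 <= s <= h ->
    is_derive s 1 (fun s => f (s *: v + (h *: w + x)) - f (s *: v + x))
      ('D_v f (s *: v + (h *: w + x)) - 'D_v f (s *: v + x)).
  have Dv y : U y -> is_derive y v f ('D_v f y).
    by move=> Uy; exact: C_k_is_derive Cf.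
  move=> sh; exact: is_deriveB (is_derive_translate (Dv _ (Uvw s sh)))
    (is_derive_translate (Dv _ (Uv s sh))).
have [|s] := MVT h0 (fun y yh => D1 y (oo_cc y yh)).
  by apply: derivable_within_continuous => y; rewrite in_itv /= => /D1; case.
rewrite in_itv /= => /andP[/ltW s0 /ltW sh]; rewrite subr0.
have {}sh : 0 <= s <= h by rewrite s0.
have D2 t : 0 <= t <= h ->
    is_derive t 1 (fun t => 'D_v f (t *: w + (s *: v + x)))
      ('D_w ('D_v f) (t *: w + (s *: v + x))).
  move=> th; apply: (@is_derive_translate _ _ _ ('D_v f)).
  by apply: C_k_is_derive (C_k_derive Ev Cf) => //; exact: Usq.
have [|t] := MVT h0 (fun y yh => D2 y (oo_cc y yh)).
  by apply: derivable_within_continuous => y; rewrite in_itv /= => /D2; case.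
rewrite in_itv /= => /andP[/ltW t0 /ltW th]; rewrite subr0.
rewrite !scale0r !add0r => Et Es.
exists s, t, ('D_w ('D_v f) (t *: w + (s *: v + x))).
split=> //; first by rewrite t0.
by rewrite -Et Es addrCA.
Qed.

Lemma continuous_eq_of_close V (f g : V -> R) x :
  {for x, continuous f} -> {for x, continuous g} ->
  (forall d : R, 0 < d -> exists y z, [/\ ball x d y, ball x d z & f y = g z]) ->
  f x = g x.
Proof.
move=> fc gc H; apply/eqP; apply: contraT; rewrite -subr_eq0 -normr_gt0 => e0.
have e2 : 0 < `|f x - g x| / 2 by rewrite divr_gt0.
have /cvgrPdist_lt /(_ _ e2) /nbhs_ballP[d1 /= d10 fd] := fc.
have /cvgrPdist_lt /(_ _ e2) /nbhs_ballP[d2 /= d20 gd] := gc.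
have [|y [z [yd zd yz]]] := H (Num.min d1 d2); first by rewrite lt_min d10.
have {}fd : `|f x - f y| < `|f x - g x| / 2.
  by apply: fd; apply: le_ball yd; rewrite ge_min lexx.
have {}gd : `|g x - g z| < `|f x - g x| / 2.
  by apply: gd; apply: le_ball zd; rewrite ge_min lexx orbT.
have : `|f x - g x| < `|f x - g x|.
  rewrite [ltRHS]splitr; apply: le_lt_trans (ltrD fd gd).
  by rewrite -yz [X in _ <= _ + X]distrC; apply: ler_distD.
by rewrite ltxx.
Qed.

(** Schwarz's theorem: by [second_difference] the two mixed derivatives take a
    common value arbitrarily close to x, and both are continuous at x. *)
Lemma mixed_derivatives_commute_real V (E U : set V) (f : V -> R) v w x :
  open U -> E v -> E w -> U x -> C_k E U 2 f ->
  'D_v ('D_w f) x = 'D_w ('D_v f) x.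
Proof.
move=> oU Ev Ew Ux Cf.
have cont a b : E a -> E b -> {for x, continuous ('D_b ('D_a f))}.
  move=> Ea Eb; apply: (C_k_continuous (C_k_derive Eb (C_k_derive Ea Cf))).
  by rewrite inE.
apply: continuous_eq_of_close (cont w v Ew Ev) (cont v w Ev Ew) _ => d d0.
have /nbhs_ballP[r /= r0 rU] : nbhs x U by exact: open_nbhs_nbhs.
have m0 : 0 < Num.min d r by rewrite lt_min d0.
have den0 : 0 < `|v| + `|w| + 1 by rewrite ltr_wpDl.
(* With this h the parallelograms stay in the ball of radius min d r. *)
pose h := Num.min d r / (`|v| + `|w| + 1).
have h0 : 0 < h by rewrite divr_gt0.
have inb a b s t : `|a| + `|b| = `|v| + `|w| -> 0 <= s <= h -> 0 <= t <= h ->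
    ball x (Num.min d r) (t *: b + (s *: a + x)).
  move=> abE /andP[s0 sh] /andP[t0 th].
  rewrite -ball_normE /= addrA opprD addrCA subrr addr0 normrN.
  apply: le_lt_trans (ler_normD _ _) _; rewrite !normrZ !ger0_norm //.
  apply: (@le_lt_trans _ _ (h * (`|v| + `|w|))).
    by rewrite -abE mulrDr addrC lerD // ler_wpM2r.
  by rewrite /h mulrAC ltr_pdivrMr // ltr_pM2l // ltrDl.
clearbody h.
have Uvw s t (sh : 0 <= s <= h) (th : 0 <= t <= h) : U (t *: w + (s *: v + x)).
  apply: rU.
  by apply: le_ball (inb v w s t _ sh th) => //; rewrite ge_min lexx orbT.
have Uwv s t (sh : 0 <= s <= h) (th : 0 <= t <= h) : U (t *: v + (s *: w + x)).
  apply: rU.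
  by apply: le_ball (inb w v s t (addrC _ _) sh th); rewrite ge_min lexx orbT.
have [s [t [c [sh th H1 E1]]]] := second_difference Ev Ew Cf h0 Uvw.
have [s' [t' [c' [sh' th' H2 E2]]]] := second_difference Ew Ev Cf h0 Uwv.
exists (t' *: v + (s' *: w + x)), (t *: w + (s *: v + x)); split.
- by apply: le_ball (inb w v s' t' (addrC _ _) sh' th'); rewrite ge_min lexx.
- by apply: le_ball (inb v w s t _ sh th) => //; rewrite ge_min lexx.
have hn0 : h * h != 0 by rewrite mulf_neq0 // gt_eqF.
apply: etrans H2 (etrans _ (esym H1)); apply: (mulIf hn0).
rewrite !mulrA -E2 -E1 [h *: w + (h *: v + x)]addrCA; ring.
Qed.

End MixedDerivatives.

(** * Calculus in the Clifford algebra *)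

Section CliffordCalculus.
Set Implicit Arguments.
Unset Strict Implicit.
Variables (R : realType) (n : nat).
Local Notation Cl := (clifford R n).

Lemma coef_linear (S : {set 'I_n}) : linear (fun x : Cl => coef x S : R^o).
Proof. by move=> a x y /=; rewrite Defs.coefD Defs.coefZ. Qed.

Lemma coef_continuous (S : {set 'I_n}) : continuous (fun x : Cl => coef x S).
Proof. exact: coord_continuous. Qed.

Lemma coef_inj (x y : Cl) : (forall S, coef x S = coef y S) -> x = y.
Proof.
move=> xy; rewrite (clifford_basis x) (clifford_basis y).
by apply: eq_bigr => S _; rewrite xy.
Qed.

Lemma clifford_coefN (x : Cl) S : coef (- x) S = - coef x S.
Proof. by rewrite /coef mxE. Qed.

Lemma clifford_mul_continuous : continuous (fun p : Cl * Cl => p.1 * p.2).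
Proof.
move=> [u v]; rewrite /continuous_at.
change (clifford_mul q.1 q.2 @[q --> (u, v)] --> clifford_mul u v).
rewrite /clifford_mul.
apply: cvg_big => [|A _]; first exact: add_continuous.
apply: cvg_big => [|B _]; first exact: add_continuous.
apply: cvgZr_tmp; apply: cvgMr_tmp; apply: cvgM.
  apply: (@cvg_comp _ _ _ fst (fun x : Cl => coef x A) _ (nbhs u)).
    exact: cvg_fst.
  exact: coef_continuous.
apply: (@cvg_comp _ _ _ snd (fun x : Cl => coef x B) _ (nbhs v)).
  exact: cvg_snd.
exact: coef_continuous.
Qed.

Lemma mul_linearl (y : Cl) : linear (fun x : Cl => x * y).
Proof. by move=> a u v; rewrite mulrDl scalerAl. Qed.

Lemma mul_linearr (y : Cl) : linear (fun x : Cl => y * x).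
Proof. by move=> a u v; rewrite mulrDr scalerAr. Qed.

Lemma mulZl (a : R) (y z : Cl) : (a *: y) * z = a *: (y * z).
Proof. by rewrite scalerAl. Qed.

Lemma mulZr (a : R) (y z : Cl) : y * (a *: z) = a *: (y * z).
Proof. by rewrite scalerAr. Qed.

Lemma is_derive_mul (V : normedModType R) (f g : V -> Cl) x v df dg :
  is_derive x v f df -> is_derive x v g dg ->
  is_derive x v (fun y => f y * g y) (df * g x + f x * dg).
Proof.
apply: is_derive_bilinear; [exact: mul_linearl|exact: mul_linearr|].
exact: clifford_mul_continuous.
Qed.

Lemma C_k_mul (V : normedModType R) (E U : set V) k (f g : V -> Cl) :
  open U -> C_k E U k f -> C_k E U k g -> C_k E U k (fun x => f x * g x).
Proof.
move=> oU; apply: C_k_bilinear => //; [exact: mul_linearl|exact: mul_linearr|].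
exact: clifford_mul_continuous.
Qed.

Lemma C_k_mull (V : normedModType R) (E U : set V) k (a : Cl) (f : V -> Cl) :
  open U -> C_k E U k f -> C_k E U k (fun x => a * f x).
Proof.
by move=> oU; apply: (C_k_mul (f := fun=> a)) => //; exact: C_k_cst.
Qed.

(** The mean value theorem only holds for real functions, hence the detour
    through the coordinates. *)
Lemma mixed_derivatives_commute (V : normedModType R) (E U : set V)
    (f : V -> Cl) v w x :
  open U -> E v -> E w -> U x -> C_k E U 2 f ->
  'D_v ('D_w f) x = 'D_w ('D_v f) x.
Proof.
move=> oU Ev Ew Ux Cf; apply: coef_inj => S.
pose L : {linear Cl -> R} := HB.pack (fun y : Cl => coef y S)
  (GRing.isLinear.Build _ _ _ _ _ (coef_linear S)).
have Lc : continuous L by exact: coef_continuous.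
have D a b : E a -> E b -> coef ('D_b ('D_a f) x) S =
    'D_b ('D_a (L \o f)) x.
  move=> Ea Eb.
  have [_ E1] := is_derive_linear Lc (C_k_is_derive Eb Ux (C_k_derive Ea Cf)).
  apply: etrans (esym E1) _.
  apply: near_eq_derive; apply: near_eq_open oU _ Ux => y /set_mem Uy.
  have [_ E2] := is_derive_linear Lc (C_k_is_derive Ea Uy Cf).
  exact: esym E2.
apply: etrans (D w v Ew Ev) (etrans _ (esym (D v w Ev Ew))).
apply: (mixed_derivatives_commute_real oU Ev Ew Ux).
exact: (C_k_linear oU Lc Cf).
Qed.

End CliffordCalculus.

(** * The axial Laplacian in the half-plane *)

(** Linear identities between Clifford-valued derivatives: these are first
    abstracted (comparing them up to conversion would unfold the limits), then
    the identity is checked on each coordinate. *)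
Ltac clifford_field :=
  cbv beta iota zeta delta [iter];
  repeat match goal with
  | |- context [@d_r ?R ?W ?f ?p] =>
      let w := fresh in generalize (@d_r R W f p); intro w
  | |- context [@d_x0 ?R ?W ?f ?p] =>
      let w := fresh in generalize (@d_x0 R W f p); intro w
  end;
  apply: coef_inj => S; rewrite !(Defs.coefD, clifford_coefN, Defs.coefZ); field.

Section HalfPlane.
Set Implicit Arguments.
Unset Strict Implicit.
Variables (R : realType) (n : nat) (D : set (R * R)).
Hypotheses (oD : open D) (D_gt0 : forall p, D p -> 0 < p.2).
Local Notation Cl := (clifford R n).
Local Notation C := (C_k (plane_dirs R) D).
Implicit Types F G : R * R -> Cl.

(** For k = n - 1 this is the operator induced by the Laplacian of R^(n+1) on
    the scalar part (c = 0) and on the vector part (c = n - 1) of an axial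
    function. *)
Definition axial_laplacian (k c : R) F : R * R -> Cl := fun p =>
  d_x0 (d_x0 F) p + d_r (d_r F) p + (k / p.2) *: d_r F p
  - (c / p.2 ^+ 2) *: F p.

Let dir_x0 : plane_dirs R (1, 0). Proof. by left. Qed.
Let dir_r : plane_dirs R (0, 1). Proof. by right. Qed.

Lemma C_k_d_x0 k F : C k.+1 F -> C k (d_x0 F).
Proof. exact: C_k_derive. Qed.

Lemma C_k_d_r k F : C k.+1 F -> C k (d_r F).
Proof. exact: C_k_derive. Qed.

Lemma is_derive_d_x0 k F p : C k.+1 F -> D p -> is_derive p (1, 0) F (d_x0 F p).
Proof. by move=> CF Dp; exact: C_k_is_derive CF. Qed.

Lemma is_derive_d_r k F p : C k.+1 F -> D p -> is_derive p (0, 1) F (d_r F p).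
Proof. by move=> CF Dp; exact: C_k_is_derive CF. Qed.

Lemma derive_eq_on (W : normedModType R) (F G : R * R -> W) (v : R * R) :
  {in D, F =1 G} -> {in D, 'D_v F =1 'D_v G}.
Proof.
by move=> FG p /set_mem Dp; apply: near_eq_derive; exact: near_eq_open oD FG Dp.
Qed.

Arguments derive_eq_on {W F G} v _ {x} _.

Lemma is_derive_snd (p v : R * R) : is_derive p v snd v.2.
Proof.
have snd_lin : linear (snd : R * R -> R^o) by [].
pose L : {linear (R * R)%type -> R} := HB.pack (snd : (R * R)%type -> R)
  (GRing.isLinear.Build _ _ _ _ _ snd_lin).
have Lc : continuous L by move=> x; exact: cvg_snd.
exact: (is_derive_linear Lc (is_derive_id p v)).
Qed.

Lemma is_derive_snd_powV (p v : R * R) (a : R) (m : nat) : 0 < p.2 ->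
  is_derive p v (fun q => a / q.2 ^+ m) (- (v.2 * (a * m%:R / p.2 ^+ m.+1))).
Proof.
move=> p0; have pn0 : p.2 != 0 by rewrite gt_eqF.
have pmn0 : p.2 ^+ m != 0 by rewrite expf_neq0.
have dX : is_derive p.2 1 (fun s : R => s ^+ m) ((m%:R * p.2 ^+ m.-1) *: 1).
  by have := is_deriveX m (is_derive_id p.2 1); rewrite exprfctE.
have dV := @is_deriveV R (fun s => s ^+ m) _ _ _ pmn0 dX.
have H := is_derive_comp_real (is_derive_snd p v) (is_deriveZ a dV).
apply: is_derive_eq H _ => /=; rewrite ![_ *: _]mulrA.
case: m {dV dX} pmn0 => [|m] pmn0; first by rewrite !(mulr0, mul0r) oppr0.
by rewrite /= !exprS; field; rewrite expf_neq0.
Qed.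

(** The derivatives of a / r^m have the same form, which makes the induction
    on k immediate. *)
Lemma C_k_snd_powV k (a : R) m : C k (fun p : R * R => a / p.2 ^+ m).
Proof.
have cont (b : R) l : {in D, continuous (fun p : R * R => b / p.2 ^+ l)}.
  move=> p /set_mem/D_gt0 p0; apply: cvgMl_tmp; apply: cvgV.
    by rewrite expf_neq0 // gt_eqF.
  apply: (@cvg_comp _ _ _ snd (fun r : R => r ^+ l) _ (nbhs p.2)).
    by case: p p0 => u v _; exact: cvg_snd.
  exact: exprn_continuous.
elim: k a m => [|k IHk] a m; first by split.
apply: (@C_kS _ _ _ _ _ _ _
  (fun v p : R * R => (- (v.2 * (a * m%:R))) / p.2 ^+ m.+1 : R)) => //.
move=> v p _ /D_gt0 p0; apply: is_derive_eq (is_derive_snd_powV v a m p0) _.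
by rewrite mulNr mulrA.
Qed.

Lemma C_k_axial_laplacian k a c F :
  C k.+2 F -> C k (axial_laplacian a c F).
Proof.
move=> CF.
have Cd v w : plane_dirs R v -> plane_dirs R w -> C k ('D_w ('D_v F)).
  by move=> Ev Ew; exact: C_k_derive (C_k_derive Ev CF).
apply: (@eq_C_k _ _ _ _ _ _ (fun p => d_x0 (d_x0 F) p + d_r (d_r F) p
  + (a / p.2 ^+ 1) *: d_r F p + (- c / p.2 ^+ 2) *: F p)) => //.
  by move=> p _; rewrite /axial_laplacian expr1 mulNr scaleNr.
apply: C_kD => //; last first.
  by apply: C_k_scale => //; [exact: C_k_snd_powV|exact/C_kW/C_kW].
apply: C_kD => //; last first.
  apply: C_k_scale => //; first exact: C_k_snd_powV.
  exact/C_kW/(C_k_derive dir_r).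
by apply: C_kD => //; exact: Cd.
Qed.

Lemma d_x0_r_comm F : C 2 F -> {in D, d_x0 (d_r F) =1 d_r (d_x0 F)}.
Proof.
move=> CF p /set_mem Dp.
exact: (mixed_derivatives_commute oD dir_x0 dir_r Dp CF).
Qed.

Lemma is_derive_scale_powV F p v (a : R) m dF :
  D p -> is_derive p v F dF ->
  is_derive p v (fun q => (a / q.2 ^+ m) *: F q)
    ((a / p.2 ^+ m) *: dF - (v.2 * (a * m%:R / p.2 ^+ m.+1)) *: F p).
Proof.
move=> Dp HF.
apply: is_derive_eq (is_derive_scale (is_derive_snd_powV v a m (D_gt0 Dp)) HF) _.
by rewrite scaleNr addrC.
Qed.

Lemma is_derive_x0_scale_powV F p (a : R) m dF :
  D p -> is_derive p (1, 0) F dF ->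
  is_derive p (1, 0) (fun q => (a / q.2 ^+ m) *: F q) ((a / p.2 ^+ m) *: dF).
Proof.
move=> Dp HF; apply: is_derive_eq (is_derive_scale_powV a m Dp HF) _.
by rewrite mul0r scale0r subr0.
Qed.

Lemma is_derive_r_scale_powV F p (a : R) m dF :
  D p -> is_derive p (0, 1) F dF ->
  is_derive p (0, 1) (fun q => (a / q.2 ^+ m) *: F q)
    ((a / p.2 ^+ m) *: dF - (a * m%:R / p.2 ^+ m.+1) *: F p).
Proof.
move=> Dp HF; apply: is_derive_eq (is_derive_scale_powV a m Dp HF) _.
by rewrite mul1r.
Qed.

(** The coefficients only depend on r, so d_x0 commutes with the operator; this
    is where the symmetry of the second derivatives is used. *)
Lemma d_x0_axial_laplacian k c F : C 3 F ->
  {in D, d_x0 (axial_laplacian k c F) =1 axial_laplacian k c (d_x0 F)}.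
Proof.
move=> CF p pD; have Dp := set_mem pD.
have C2 := C_kW CF; have Cx := C_k_d_x0 CF; have Cr := C_k_d_r CF.
have dF := is_derive_d_x0 C2 Dp.
have dFr := is_derive_d_x0 Cr Dp.
have dFxx := is_derive_d_x0 (C_k_d_x0 Cx) Dp.
have dFrr := is_derive_d_x0 (C_k_d_r Cr) Dp.
have [_ E] := is_deriveB (is_deriveD (is_deriveD dFxx dFrr)
  (is_derive_x0_scale_powV k 1 Dp dFr)) (is_derive_x0_scale_powV c 2 Dp dF).
apply: etrans E _.
have E1 := d_x0_r_comm C2 pD.
have E2 : d_x0 (d_r (d_r F)) p = d_r (d_r (d_x0 F)) p.
  apply: etrans (d_x0_r_comm Cr pD) _.
  exact: (derive_eq_on (0, 1) (d_x0_r_comm C2) pD).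
exact: (congr2 (fun u v => _ + u + (k / p.2) *: v - _) E2 E1).
Qed.

Lemma d_r_axial_laplacian k c F : C 3 F ->
  {in D, d_r (axial_laplacian k c F) =1 fun p =>
     d_r (d_x0 (d_x0 F)) p + iter 3 d_r F p + (k / p.2 ^+ 1) *: iter 2 d_r F p
     - ((k + c) / p.2 ^+ 2) *: d_r F p + (2 * c / p.2 ^+ 3) *: F p}.
Proof.
move=> CF p pD; have Dp := set_mem pD.
have C2 := C_kW CF; have Cx := C_k_d_x0 CF; have Cr := C_k_d_r CF.
have dF := is_derive_d_r C2 Dp.
have dFr := is_derive_d_r Cr Dp.
have dFxx := is_derive_d_r (C_k_d_x0 Cx) Dp.
have dFrr := is_derive_d_r (C_k_d_r Cr) Dp.
have [_ E] := is_deriveB (is_deriveD (is_deriveD dFxx dFrr)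
  (is_derive_r_scale_powV k 1 Dp dFr)) (is_derive_r_scale_powV c 2 Dp dF).
apply: etrans E _.
have p0 : p.2 != 0 by rewrite gt_eqF // D_gt0.
by clifford_field.
Qed.

Lemma d_rr_axial_laplacian k c F : C 4 F ->
  {in D, d_r (d_r (axial_laplacian k c F)) =1 fun p =>
     iter 2 d_r (iter 2 d_x0 F) p + iter 4 d_r F p
     + (k / p.2 ^+ 1) *: iter 3 d_r F p
     - ((2 * k + c) / p.2 ^+ 2) *: iter 2 d_r F p
     + ((2 * k + 4 * c) / p.2 ^+ 3) *: d_r F p
     - (6 * c / p.2 ^+ 4) *: F p}.
Proof.
move=> CF p pD; have Dp := set_mem pD.
have C3 := C_kW CF; have C2 := C_kW C3.
have Cx := C_k_d_x0 CF; have Cr := C_k_d_r CF.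
have dF := is_derive_d_r C2 Dp.
have dFr := is_derive_d_r Cr Dp.
have dFrr := is_derive_d_r (C_k_d_r Cr) Dp.
have dFrrr := is_derive_d_r (C_k_d_r (C_k_d_r Cr)) Dp.
have dFxxr := is_derive_d_r (C_k_d_r (C_k_d_x0 Cx)) Dp.
apply: etrans (derive_eq_on (0, 1) (d_r_axial_laplacian k c C3) pD) _.
have [_ E] := is_deriveD (is_deriveB (is_deriveD (is_deriveD dFxxr dFrrr)
  (is_derive_r_scale_powV k 1 Dp dFrr)) (is_derive_r_scale_powV (k + c) 2 Dp dFr))
  (is_derive_r_scale_powV (2 * c) 3 Dp dF).
apply: etrans E _.
have p0 : p.2 != 0 by rewrite gt_eqF // D_gt0.
by clifford_field.
Qed.

Lemma d_xxr_comm F : C 3 F ->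
  {in D, iter 2 d_x0 (d_r F) =1 d_r (iter 2 d_x0 F)}.
Proof.
move=> CF p pD.
apply: etrans (derive_eq_on (1, 0) (d_x0_r_comm (C_kW CF)) pD) _.
exact: d_x0_r_comm (C_k_d_x0 CF) _ pD.
Qed.

Lemma d_xxrr_comm F : C 4 F ->
  {in D, iter 2 d_x0 (iter 2 d_r F) =1 iter 2 d_r (iter 2 d_x0 F)}.
Proof.
move=> CF p pD; apply: etrans (d_xxr_comm (C_k_d_r CF) pD) _.
exact: (derive_eq_on (0, 1) (d_xxr_comm (C_kW CF)) pD).
Qed.

Lemma axial_bilaplacianE k c F : C 4 F ->
  {in D, axial_laplacian k c (axial_laplacian k c F) =1 fun p =>
    iter 4 d_x0 F p + 2 *: iter 2 d_r (iter 2 d_x0 F) p + iter 4 d_r F p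
    + (2 * k / p.2) *: iter 3 d_r F p
    + ((k ^+ 2 - 2 * k - 2 * c) / p.2 ^+ 2) *: iter 2 d_r F p
    + ((2 * k - k ^+ 2 + 4 * c - 2 * k * c) / p.2 ^+ 3) *: d_r F p
    + ((c ^+ 2 + 2 * k * c - 6 * c) / p.2 ^+ 4) *: F p
    + (2 * k / p.2) *: d_r (iter 2 d_x0 F) p
    - (2 * c / p.2 ^+ 2) *: iter 2 d_x0 F p}.
Proof.
move=> CF p pD; have C3 := C_kW CF.
have Cx := C_k_d_x0 CF.
rewrite {1}/axial_laplacian d_rr_axial_laplacian // d_r_axial_laplacian //.
have E : d_x0 (d_x0 (axial_laplacian k c F)) p =
    axial_laplacian k c (d_x0 (d_x0 F)) p.
  apply: etrans (derive_eq_on (1, 0) (d_x0_axial_laplacian k c C3) pD) _.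
  exact: d_x0_axial_laplacian Cx _ pD.
rewrite E /axial_laplacian.
have p0 : p.2 != 0 by rewrite gt_eqF // D_gt0 //; exact: set_mem.
by clifford_field.
Qed.

End HalfPlane.

(** * Radius and direction *)

Section AxialFunctions.
Set Implicit Arguments.
Unset Strict Implicit.
Variables (R : realType) (n : nat).
Local Notation Cl := (clifford R n).
Local Notation P := 'rV[R]_n.+1.
Local Notation coord := Defs.coord.
Implicit Types (x : P) (i j : 'I_n).

Definition axis (i : 'I_n.+1) : P := delta_mx 0 i.

Definition cyl x : R * R := (repart x, vnorm x).

Definition dircoord i x : R := coord x (lift ord0 i) / vnorm x.

Lemma vdirE x : Defs.vdir x = \sum_i dircoord i x *: gen R i.
Proof.
rewrite /Defs.vdir scaler_sumr; apply: eq_bigr => i _.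
by rewrite scalerA mulrC.
Qed.

Lemma vnorm_sqr x : vnorm x ^+ 2 = \sum_i coord x (lift ord0 i) ^+ 2.
Proof. by rewrite sqr_sqrtr // sumr_ge0 // => i _; rewrite sqr_ge0. Qed.

Lemma sum_sqr_dircoord x : vnorm x != 0 -> \sum_i dircoord i x ^+ 2 = 1.
Proof.
move=> x0; under eq_bigr do rewrite expr_div_n.
by rewrite -mulr_suml -vnorm_sqr divff // expf_neq0.
Qed.

Lemma is_derive_coord (k l : 'I_n.+1) x :
  is_derive x (axis k) (fun y => coord y l) (k == l)%:R.
Proof.
have coord_lin : linear ((fun y : P => coord y l) : P -> R^o).
  by move=> a y z; rewrite /Defs.coord !mxE.
pose L : {linear P -> R} := HB.pack (fun y : P => coord y l)
  (GRing.isLinear.Build _ _ _ _ _ coord_lin).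
have Lc : continuous L by exact: coord_continuous.
have := is_derive_linear Lc (is_derive_id x (axis k)).
by congr is_derive; rewrite /= /Defs.coord /axis mxE eqxx /= eq_sym.
Qed.

Lemma is_derive_vnorm i x : 0 < vnorm x ->
  is_derive x (axis (lift ord0 i)) (@vnorm R n) (dircoord i x).
Proof.
move=> x0.
have s0 : 0 < \sum_j coord x (lift ord0 j) ^+ 2 by rewrite -vnorm_sqr exprn_gt0.
have dsq j := is_deriveX 2 (is_derive_coord (lift ord0 i) (lift ord0 j) x).
have dsum := is_derive_sum dsq.
have dsum' : is_derive x (axis (lift ord0 i))
    (fun y => \sum_j coord y (lift ord0 j) ^+ 2) (2 * coord x (lift ord0 i)).
  rewrite (_ : (fun y => _) =
     \sum_j (fun y : P => coord y (lift ord0 j)) ^+ 2); last first.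
    by apply/funext => y; rewrite fct_sumE; apply: eq_bigr => j _; rewrite exprfctE.
  apply: is_derive_eq dsum _.
  rewrite (bigD1 i) //= eqxx big1 ?addr0 => [|j ji].
    by rewrite expr1 [_ *: _]mulr1.
  by rewrite (inj_eq lift_inj) eq_sym (negbTE ji) scaler0.
apply: is_derive_eq (is_derive_comp_real dsum' (is_derive1_sqrt s0)) _.
rewrite -/(vnorm x) /dircoord [LHS]mulrC invfM -!mulrA [2^-1 * _]mulrCA.
by field; rewrite gt_eqF.
Qed.

(** Moving along a vector axis leaves x_0 fixed: this is the chain rule for the
    function F (x_0, -) of r alone. *)
Lemma is_derive_radial (W : normedModType R) (F : R * R -> W) i x (dF : W) :
  0 < vnorm x -> is_derive (cyl x) (0, 1) F dF ->
  is_derive x (axis (lift ord0 i)) (fun y => F (cyl y)) (dircoord i x *: dF).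
Proof.
move=> x0 /is_derive_lineP HF.
have HG : is_derive (vnorm x) 1 (fun s => F (repart x, s)) dF.
  apply/is_derive_lineP; move: HF; congr is_derive; apply/funext => h.
  by congr F; congr pair; rewrite /= [h *: _]mulr0 add0r.
have /is_derive_lineP := is_derive_comp_real (is_derive_vnorm i x0) HG.
move=> H; apply/is_derive_lineP; move: H; congr is_derive; apply/funext => h.
congr F; congr pair.
by rewrite /repart /Defs.coord !mxE /= mulr0 add0r.
Qed.

Lemma vector_part_const (h : R) x i :
  coord (h *: axis ord0 + x) (lift ord0 i) = coord x (lift ord0 i).
Proof. by rewrite /Defs.coord !mxE /= mulr0 add0r. Qed.

Lemma vnorm_const (h : R) x : vnorm (h *: axis ord0 + x) = vnorm x.
Proof.
by rewrite /vnorm; congr Num.sqrt; apply: eq_bigr => i _; rewrite vector_part_const.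
Qed.

Lemma vdir_const (h : R) x : Defs.vdir (h *: axis ord0 + x) = Defs.vdir x.
Proof.
rewrite /Defs.vdir vnorm_const; congr (_ *: _).
by apply: eq_bigr => i _; rewrite vector_part_const.
Qed.

Lemma is_derive_axial0 (F : R * R -> Cl) x (dF : Cl) :
  is_derive (cyl x) (1, 0) F dF ->
  is_derive x (axis ord0) (fun y => F (cyl y)) dF.
Proof.
move=> /is_derive_lineP HF; apply/is_derive_lineP; move: HF.
congr is_derive; apply/funext => h; congr F; congr pair => /=.
  by rewrite /repart /Defs.coord !mxE eqxx.
by rewrite vnorm_const [h *: _]mulr0 add0r.
Qed.

Lemma is_derive_vdir0 x : is_derive x (axis ord0) (@Defs.vdir R n) 0.
Proof.
apply/is_derive_lineP.
rewrite (_ : (fun h : R => _) = cst (Defs.vdir x)); first exact: is_derive_cst.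
by apply/funext => h; rewrite vdir_const.
Qed.

Lemma is_derive_vnorm_inv i x : 0 < vnorm x ->
  is_derive x (axis (lift ord0 i)) (fun y => (vnorm y)^-1)
    (- (dircoord i x * (vnorm x)^-1 ^+ 2)).
Proof.
move=> x0; have xn0 : vnorm x != 0 by rewrite gt_eqF.
have dV := @is_deriveV R id _ _ _ xn0 (is_derive_id (vnorm x) 1).
apply: is_derive_eq (is_derive_comp_real (is_derive_vnorm i x0) dV) _.
by rewrite [X in _ *: X]mulr1 [LHS]mulrN exprVn.
Qed.

Lemma is_derive_dircoord i j x : 0 < vnorm x ->
  is_derive x (axis (lift ord0 i)) (dircoord j)
    ((vnorm x)^-1 * ((i == j)%:R - dircoord i x * dircoord j x)).
Proof.
move=> x0; have dc := is_derive_coord (lift ord0 i) (lift ord0 j) x.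
apply: is_derive_eq (is_deriveM dc (is_derive_vnorm_inv i x0)) _.
rewrite (inj_eq lift_inj) ![_ *: _]mulrC /dircoord.
by field; rewrite gt_eqF.
Qed.

Lemma is_derive_vdir i x : 0 < vnorm x ->
  is_derive x (axis (lift ord0 i)) (@Defs.vdir R n)
    ((vnorm x)^-1 *: (gen R i - dircoord i x *: Defs.vdir x)).
Proof.
move=> x0.
have dterm j := is_derive_scale (is_derive_dircoord i j x0)
  (is_derive_cst (gen R j) x (axis (lift ord0 i))).
have vdir_sum : \sum_j (fun y => dircoord j y *: gen R j) = @Defs.vdir R n.
  by apply/funext => y; rewrite vdirE fct_sumE.
rewrite -[X in is_derive _ _ X]vdir_sum.
apply: is_derive_eq (is_derive_sum dterm) _.
rewrite vdirE scaler_sumr (bigD1 i) //= eqxx scaler0 addr0.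
rewrite [X in _ = _ *: (_ - X)](bigD1 i) //= opprD addrA scalerDr.
congr (_ + _).
  by rewrite -scalerA scalerBl scale1r scalerA.
rewrite scalerN scaler_sumr -sumrN; apply: eq_bigr => j ji.
rewrite eq_sym (negbTE ji) sub0r scaler0 addr0 mulrN scaleNr.
by rewrite !scalerA.
Qed.

End AxialFunctions.

(** * Laplacian and components of axial functions *)

Section AxialLaplacian.
Set Implicit Arguments.
Unset Strict Implicit.
Variables (R : realType) (n : nat) (D : set (R * R)).
Hypotheses (oD : open D) (D_gt0 : forall p, D p -> 0 < p.2).
Local Notation Cl := (clifford R n).
Local Notation P := 'rV[R]_n.+1.
Local Notation C := (C_k (plane_dirs R) D).
Local Notation U := (induced_set n D).
Local Notation coord := Defs.coord.
Local Notation vdir := Defs.vdir.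
Implicit Types (x : P) (i j : 'I_n) (A B : R * R -> Cl) (g : P -> Cl).

Lemma open_induced_set : open U.
Proof.
apply: (@open_comp _ _ (@cyl R n) D) => // x _.
have repart_cont : continuous (@repart R n) by exact: coord_continuous.
have vnorm_cont : continuous (@vnorm R n).
  have sum_cont : continuous (fun y : P => \sum_i coord y (lift ord0 i) ^+ 2).
    apply: continuous_big => [|i _ y]; first exact: add_continuous.
    have ci : continuous (fun y : P => coord y (lift ord0 i)).
      exact: coord_continuous.
    exact: cvg_comp (ci y) (@exprn_continuous _ _ _).
  by move=> y; exact: cvg_comp (sum_cont y) (@sqrt_continuous _ _).
exact: cvg_pair (repart_cont x) (vnorm_cont x).
Qed.

Lemma is_derive_eq_on g h x v dh :
  (forall y, U y -> g y = h y) -> U x -> is_derive x v h dh -> 'D_v g x = dh.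
Proof.
move=> gh Ux [hx <-]; apply: near_eq_derive.
by apply: near_eq_open open_induced_set _ Ux => y /set_mem; exact: gh.
Qed.

Lemma axial_repr_pderiv0 g A B : C 1 A -> C 1 B ->
  axial_repr D g A B -> axial_repr D (pderiv ord0 g) (d_x0 A) (d_x0 B).
Proof.
move=> CA CB gAB x Ux.
have dA := is_derive_axial0 (is_derive_d_x0 CA Ux).
have dB := is_derive_axial0 (is_derive_d_x0 CB Ux).
have := is_deriveD dA (is_derive_mul (is_derive_vdir0 x) dB).
by rewrite mul0r add0r; exact: is_derive_eq_on.
Qed.

Lemma pderiv_lift_axial g A B i x : C 1 A -> C 1 B -> axial_repr D g A B -> U x ->
  pderiv (lift ord0 i) g x = dircoord i x *: d_r A (cyl x) +
   (((vnorm x)^-1 *: (gen R i - dircoord i x *: vdir x)) * B (cyl x)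
    + vdir x * (dircoord i x *: d_r B (cyl x))).
Proof.
move=> CA CB gAB Ux; have x0 : 0 < vnorm x := D_gt0 Ux.
have dA := is_derive_radial i x0 (is_derive_d_r CA Ux).
have dB := is_derive_radial i x0 (is_derive_d_r CB Ux).
have := is_deriveD dA (is_derive_mul (is_derive_vdir i x0) dB).
exact: is_derive_eq_on.
Qed.

(** The terms are grouped by their dependence on i, as c_i^2 X + c_i e_i Y + Z,
    so that the sum over i is X + omega Y + n Z. *)
Lemma pderiv2_lift_axial g A B i x : C 2 A -> C 2 B -> axial_repr D g A B -> U x ->
  let u := (vnorm x)^-1 in let c := dircoord i x in
  pderiv (lift ord0 i) (pderiv (lift ord0 i) g) x =
  c ^+ 2 *: (d_r (d_r A) (cyl x) - u *: d_r A (cyl x)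
    + vdir x * ((3 * u ^+ 2) *: B (cyl x) - (3 * u) *: d_r B (cyl x)
                + d_r (d_r B) (cyl x)))
  + c *: (gen R i * ((2 * u) *: d_r B (cyl x) - (2 * u ^+ 2) *: B (cyl x)))
  + (u *: d_r A (cyl x) + vdir x * (u *: d_r B (cyl x) - u ^+ 2 *: B (cyl x))).
Proof.
move=> CA CB gAB Ux /=; have x0 : 0 < vnorm x := D_gt0 Ux.
have dB := is_derive_radial i x0 (is_derive_d_r CB Ux).
have dAr := is_derive_radial i x0 (is_derive_d_r (C_k_d_r CA) Ux).
have dBr := is_derive_radial i x0 (is_derive_d_r (C_k_d_r CB) Ux).
have dc := is_derive_dircoord i i x0; rewrite eqxx in dc.
have du := is_derive_vnorm_inv i x0.
have dw := is_derive_vdir i x0.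
have dtan : is_derive x (axis R (lift ord0 i))
    (fun y => gen R i - dircoord i y *: vdir y) _ :=
  is_deriveB (is_derive_cst (gen R i) _ _) (is_derive_scale dc dw).
have := is_deriveD (is_derive_scale dc dAr) (is_deriveD
  (is_derive_mul (is_derive_scale du dtan) dB)
  (is_derive_mul dw (is_derive_scale dc dBr))).
move=> /(is_derive_eq_on (fun y Uy => pderiv_lift_axial i (C_kW CA) (C_kW CB) gAB Uy) Ux).
move=> H; apply: etrans H _; rewrite sub0r -[true%:R]/(1 : R); cbv beta.
move: (vnorm x)^-1 (dircoord i x) (vdir x) => u c w.
move: (d_r (d_r A) _) (d_r (d_r B) _) (d_r A _) (d_r B _) (B _) => Arr Brr Ar Br Bx.
rewrite !(@mulrDl Cl, @mulrDr Cl, @mulNr Cl, @mulrN Cl, mulZl, mulZr).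
apply: coef_inj => S.
rewrite !(Defs.coefD, clifford_coefN, Defs.coefZ).
by ring.
Qed.

Lemma laplacian_axial g A B : C 2 A -> C 2 B -> axial_repr D g A B ->
  axial_repr D (laplacian g) (axial_laplacian (n%:R - 1) 0 A)
                             (axial_laplacian (n%:R - 1) (n%:R - 1) B).
Proof.
move=> CA CB gAB x Ux; have x0 : 0 < vnorm x := D_gt0 Ux.
have g00 := axial_repr_pderiv0 (C_k_d_x0 CA) (C_k_d_x0 CB)
  (axial_repr_pderiv0 (C_kW CA) (C_kW CB) gAB) Ux.
rewrite /laplacian big_ord_recl g00.
under eq_bigr do rewrite (pderiv2_lift_axial _ CA CB gAB Ux).
rewrite big_split big_split /= -scaler_suml sum_sqr_dircoord ?gt_eqF // scale1r.
under [X in _ + (_ + X + _)]eq_bigr do rewrite -mulZl.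
rewrite -mulr_suml -vdirE sumr_const card_ord.
rewrite /axial_laplacian -/(cyl x) [in (cyl x).2]/cyl /=.
rewrite -[_ *+ n]scaler_nat.
move: (vdir x) (vnorm x) x0 => w r r0.
move: (d_x0 (d_x0 A) _) (d_x0 (d_x0 B) _).
move: (d_r (d_r A) _) (d_r (d_r B) _) (d_r A _) (d_r B _) (B _) (A _).
move=> Arr Brr Ar Br Bx Ax Axx Bxx.
rewrite !(@mulrDr Cl, @mulrN Cl, mulZr); apply: coef_inj => S.
rewrite !(Defs.coefD, clifford_coefN, Defs.coefZ).
by field; rewrite gt_eqF.
Qed.

(** The half-plane of the points x_0 + r e_i, on which omega = e_i. *)
Definition half_plane i (p : R * R) : P :=
  p.1 *: axis R ord0 + p.2 *: axis R (lift ord0 i).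

Lemma half_plane_linear i : linear (half_plane i).
Proof.
move=> a p q; rewrite /half_plane /= !scalerDl !scalerDr !scalerA.
by rewrite addrACA.
Qed.

Lemma coord_half_plane i j p :
  coord (half_plane i p) (lift ord0 j) = p.2 * (i == j)%:R.
Proof.
by rewrite /Defs.coord /half_plane !mxE /= mulr0 add0r (inj_eq lift_inj) eq_sym.
Qed.

Lemma vnorm_half_plane i p : D p -> vnorm (half_plane i p) = p.2.
Proof.
move=> /D_gt0 p0; rewrite /vnorm (bigD1 i) //= big1 => [|j ji].
  by rewrite coord_half_plane eqxx mulr1 addr0 sqrtr_sqr gtr0_norm.
by rewrite coord_half_plane eq_sym (negbTE ji) mulr0 expr0n.
Qed.

Lemma cyl_half_plane i p : D p -> cyl (half_plane i p) = p.
Proof.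
move=> Dp; rewrite /cyl vnorm_half_plane //; case: p Dp => u v Dp.
by rewrite /repart /Defs.coord /half_plane !mxE /= mulr1 mulr0 addr0.
Qed.

Lemma half_plane_induced i p : D p -> U (half_plane i p).
Proof. by move=> Dp; rewrite /induced_set /= -/(cyl _) cyl_half_plane. Qed.

Lemma vdir_half_plane i p : D p -> vdir (half_plane i p) = gen R i.
Proof.
move=> Dp; have p0 := D_gt0 Dp.
rewrite vdirE (bigD1 i) //= big1 ?addr0 => [|j ji].
  rewrite /dircoord coord_half_plane vnorm_half_plane // eqxx mulr1.
  by rewrite divff ?scale1r // gt_eqF.
by rewrite /dircoord coord_half_plane eq_sym (negbTE ji) mulr0 mul0r scale0r.
Qed.

Lemma axial_repr_half_plane g A B i p : axial_repr D g A B -> D p ->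
  g (half_plane i p) = A p + gen R i * B p.
Proof.
move=> gAB Dp; rewrite gAB; last exact: half_plane_induced.
by rewrite -/(cyl _) cyl_half_plane // vdir_half_plane.
Qed.

(** Subtracting the values on two half-planes cancels A and leaves
    (e_i - e_j) B, and (e_i - e_j)^2 = -2. *)
Lemma axial_component_vector g A B i j p : i != j ->
  axial_repr D g A B -> D p ->
  B p = (- 2^-1) *: ((gen R i - gen R j) *
                     (g (half_plane i p) - g (half_plane j p))).
Proof.
move=> ij gAB Dp; rewrite !(axial_repr_half_plane _ gAB Dp).
rewrite opprD addrACA subrr add0r -mulrBl mulrA.
rewrite [_ * (gen R i - gen R j)](_ : _ = (- 2) *: 1); last first.
  rewrite mulrBl !mulrBr !gen_sqr (gen_anticomm R ij).
  by rewrite !opprK opprD addrA addrK scaleNr scaler_nat -opprD.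
by rewrite mulZl mul1r scalerA mulrNN mulVf ?scale1r.
Qed.

Lemma axial_component_scalar g A B i p :
  axial_repr D g A B -> D p -> A p = g (half_plane i p) - gen R i * B p.
Proof. by move=> gAB Dp; rewrite (axial_repr_half_plane _ gAB Dp) addrK. Qed.

Lemma C_k_axial_components k g A B i j : i != j ->
  axial_repr D g A B -> C_k (coord_dirs n) U k g -> C k A /\ C k B.
Proof.
move=> ij gAB Cg.
have Ch l : C k (g \o half_plane l).
  pose L : {linear (R * R)%type -> P} := HB.pack (half_plane l)
    (GRing.isLinear.Build _ _ _ _ _ (half_plane_linear l)).
  apply: (@C_k_comp_linear _ _ _ _ _ _ (coord_dirs n) U _ L) Cg.
  - move=> p; apply: cvgD.
      by apply: cvgZr_tmp; case: p => u v; exact: cvg_fst.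
    by apply: cvgZr_tmp; case: p => u v; exact: cvg_snd.
  - move=> v [->|->]; rewrite /= /half_plane /= scale1r scale0r.
      by rewrite addr0; exists ord0.
    by rewrite add0r; exists (lift ord0 l).
  - by move=> p; exact: half_plane_induced.
have CB : C k B.
  apply: (@eq_C_k _ _ _ _ _ _ (fun p => (- 2^-1 : R) *: ((gen R i - gen R j) *
                     (g (half_plane i p) + (- 1 : R) *: g (half_plane j p))))) => //.
    by move=> p /set_mem Dp; rewrite scaleN1r -(axial_component_vector ij gAB Dp).
  apply: C_kZ => //; apply: C_k_mull => //.
  by apply: C_kD; [|exact: Ch|apply: C_kZ; [|exact: Ch]].
split=> //.
apply: (@eq_C_k _ _ _ _ _ _ (fun p => g (half_plane i p) + (- gen R i) * B p)) => //.
  by move=> p /set_mem Dp; rewrite mulNr -(axial_component_scalar i gAB Dp).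
by apply: C_kD; [|exact: Ch|exact: C_k_mull].
Qed.

Lemma axial_components_eq0 g A B i j : i != j -> axial_repr D g A B ->
  (forall x, U x -> g x = 0) -> forall p, D p -> A p = 0 /\ B p = 0.
Proof.
move=> ij gAB g0 p Dp.
have gh l : g (half_plane l p) = 0 by rewrite g0 //; exact: half_plane_induced.
have B0 : B p = 0 by rewrite (axial_component_vector ij gAB Dp) !gh subr0 mulr0 scaler0.
by split=> //; rewrite (axial_component_scalar i gAB Dp) gh B0 mulr0 subr0.
Qed.

Lemma C_k_dirac k g : C_k (coord_dirs n) U k.+1 g ->
  C_k (coord_dirs n) U k (Defs.dirac g).
Proof.
move=> Cf; have oU := open_induced_set.
have Cd l : C_k (coord_dirs n) U k (pderiv l g).
  by apply: C_k_derive Cf; exists l.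
apply: C_kD => //; apply: C_k_sum => // i.
exact: C_k_mull.
Qed.

End AxialLaplacian.

(** * The system for bi-harmonic functions *)

Theorem theorem5p2 (R : realType) (D : set (R * R))
    (f1 : 'rV[R]_6 -> clifford R 5) (A B : R * R -> clifford R 5) :
  upper_half_plane_domain D ->
  axially_biharmonic D f1 ->
  axial_repr D f1 A B ->
  [/\ C_k (plane_dirs R) D 4 A,
      C_k (plane_dirs R) D 4 B &
      forall x0 r : R, D (x0, r) ->
        iter 4 d_x0 A (x0, r)
        + 2 *: iter 2 d_x0 (iter 2 d_r A) (x0, r)
        + iter 4 d_r A (x0, r)
        - (8 / r ^+ 3) *: d_r A (x0, r)
        + (8 / r ^+ 2) *: iter 2 d_r A (x0, r)
        + (8 / r) *: iter 3 d_r A (x0, r)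
        + (8 / r) *: d_r (iter 2 d_x0 A) (x0, r) = 0
        /\
        iter 4 d_r B (x0, r)
        + (8 / r) *: iter 3 d_r B (x0, r)
        - (24 / r ^+ 3) *: d_r B (x0, r)
        + (24 / r ^+ 4) *: B (x0, r)
        + 2 *: iter 2 d_r (iter 2 d_x0 B) (x0, r)
        - (8 / r ^+ 2) *: iter 2 d_x0 B (x0, r)
        + (8 / r) *: iter 2 d_x0 (d_r B) (x0, r)
        + iter 4 d_x0 B (x0, r) = 0].
Proof.
move=> [oD _ _ D_gt0] [[f [_ Cf f1E]] bih] f1AB.
have oU : open (induced_set 5 D) by exact: open_induced_set.
have Cf1 : C_k (coord_dirs 5) (induced_set 5 D) 4 f1.
  apply: (@eq_C_k _ _ _ _ _ _ (Defs.dirac f)) => //; last exact: C_k_dirac.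
  by move=> x /set_mem Ux; rewrite f1E.
(* Any two distinct vector axes serve to separate the components. *)
have ij : (ord0 : 'I_5) != ord_max by [].
have [CA CB] := C_k_axial_components oD D_gt0 ij f1AB Cf1.
have L1 := laplacian_axial oD D_gt0 (C_kW (C_kW CA)) (C_kW (C_kW CB)) f1AB.
have L2 := laplacian_axial oD D_gt0 (C_k_axial_laplacian oD D_gt0 _ _ CA)
  (C_k_axial_laplacian oD D_gt0 _ _ CB) L1.
split=> // x0 r Dp; have pD := mem_set Dp.
have [] := axial_components_eq0 D_gt0 ij L2 bih Dp.
rewrite !(axial_bilaplacianE oD D_gt0 _ _ _ pD) // -[(x0, r).2]/r => EA EB.
have r0 : r != 0 by rewrite gt_eqF // (D_gt0 _ Dp).
split.
- rewrite (d_xxrr_comm oD CA pD); apply: etrans EA.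
  by clifford_field.
- rewrite (d_xxr_comm oD (C_kW CB) pD); apply: etrans EB.
  by clifford_field.
Qed.
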